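(* Let $n,k,m\ge 1$ be integers, and let $S_1,\dots,S_k$ and $C_1,\dots,C_m$ be nonempty, closed, convex subsets of $\mathbb{R}^n$. If at least one of the sets $S_1,\dots,S_k,C_1,\dots,C_m$ is bounded, then the generalized $(k,m)$-Heron problem $$\min\ F(x_1,\dots,x_k,y_1,\dots,y_m)=\sum_{i=1}^k\sum_{j=1}^m\|x_i-y_j\|\quad\text{s.t. } x_i\in S_i\ (i=1,\dots,k),\ y_j\in C_j\ (j=1,\dots,m)$$ has an optimal solution, i.e. there is a point $Z^*\in A:=S_1\times\cdots\times S_k\times C_1\times\cdots\times C_m$ with $F(Z^* )\le F(Z)$ for all $Z\in A$.
   Context: $\|\cdot\|$ denotes the Euclidean norm on $\mathbb{R}^n$. The $S_i$ are called feasible sets and the $C_j$ target sets. *)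

(* Defs.v *)
From mathcomp Require Import all_boot all_order all_algebra.
From mathcomp Require Import all_classical all_reals all_analysis.

Set Implicit Arguments.
Unset Strict Implicit.
Unset Printing Implicit Defensive.

Import Order.TTheory GRing.Theory Num.Theory.
Import numFieldNormedType.Exports.

Local Open Scope classical_set_scope.
Local Open Scope ring_scope.

(* The norm [`|x|] that the library puts on ['rV[R]_n] is the sup norm, so the
   Euclidean norm needs its own definition.  [nbhs_enormP] and
   [bounded_set_enormP] show that the library's topology and its [bounded_set]
   on ['rV[R]_n] are the ones given by [enorm]. *)
Definition enorm (R : realType) (n : nat) (x : 'rV[R]_n) : R :=
  Num.sqrt (\sum_(i < n) x ord0 i ^+ 2).

Definition heron_feasible (R : realType) (n k m : nat)
    (S : 'I_k -> set 'rV[R]_n) (C : 'I_m -> set 'rV[R]_n) :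
    set (('I_k -> 'rV[R]_n) * ('I_m -> 'rV[R]_n)) :=
  [set Z | (forall i, S i (Z.1 i)) /\ (forall j, C j (Z.2 j))].

Definition heron_objective (R : realType) (n k m : nat)
    (Z : ('I_k -> 'rV[R]_n) * ('I_m -> 'rV[R]_n)) : R :=
  \sum_(i < k) \sum_(j < m) enorm (Z.1 i - Z.2 j).

Lemma enorm_ge0 (R : realType) (n : nat) (x : 'rV[R]_n) : 0 <= enorm x.
Proof. exact: sqrtr_ge0. Qed.

Lemma ler_coord_mx_norm (R : realType) (n : nat) (x : 'rV[R]_n) (i : 'I_n) :
  `|x ord0 i| <= `|x|.
Proof.
rewrite [leRHS]/Num.norm /= mx_normrE; apply/bigmax_geP; right => /=.
by exists (ord0, i).
Qed.

Lemma mx_norm_le_enorm (R : realType) (n : nat) (x : 'rV[R]_n) :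
  `|x| <= enorm x.
Proof.
rewrite [leLHS]/Num.norm /= mx_normrE; apply/bigmax_leP; split.
  exact: enorm_ge0.
move=> [i j] _ /=; rewrite (ord1 i) -sqrtr_sqr ler_wsqrtr//.
by rewrite (bigD1 j)//= lerDl sumr_ge0// => l _; exact: sqr_ge0.
Qed.

Lemma enorm_le_mx_norm (R : realType) (n : nat) (x : 'rV[R]_n) :
  enorm x <= Num.sqrt n%:R * `|x|.
Proof.
rewrite -[X in _ * X]ger0_norm// -sqrtr_sqr -sqrtrM ?ler0n// ler_wsqrtr//.
apply: (@le_trans _ _ (\sum_(i < n) `|x| ^+ 2)).
  apply: ler_sum => i _.
  by rewrite -real_normK ?num_real// lerXn2r ?nnegrE// ler_coord_mx_norm.
by rewrite sumr_const card_ord mulr_natl.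
Qed.

Lemma nbhs_enormP (R : realType) (n : nat) (x : 'rV[R]_n) (A : set 'rV[R]_n) :
  nbhs x A <-> exists2 e : R, 0 < e & forall y, enorm (y - x) < e -> A y.
Proof.
split=> [/nbhs_normP[e /= e0 eA]|[e e0 eA]].
  exists e => // y xye; apply: eA => /=; rewrite distrC.
  exact: le_lt_trans (mx_norm_le_enorm _) xye.
have s0 : 0 < Num.sqrt n%:R + 1 :> R by rewrite ltr_wpDl// sqrtr_ge0.
apply/nbhs_ballP; exists (e / (Num.sqrt n%:R + 1)) => /=; first exact: divr_gt0.
move=> y; rewrite -ball_normE /= distrC => xye; apply: eA.
apply: le_lt_trans (enorm_le_mx_norm _) _.
apply: (@le_lt_trans _ _ ((Num.sqrt n%:R + 1) * `|y - x|)).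
  by rewrite ler_wpM2r// lerDl.
by rewrite mulrC -ltr_pdivlMr.
Qed.

Lemma bounded_set_enormP (R : realType) (n : nat) (A : set 'rV[R]_n) :
  bounded_set A <-> exists M : R, forall x, A x -> enorm x <= M.
Proof.
split=> [[M [_ AM]]|[M AM]].
  exists (Num.sqrt n%:R * (M + 1)) => x Ax.
  apply: le_trans (enorm_le_mx_norm _) _.
  by rewrite ler_wpM2l ?sqrtr_ge0// AM// ltrDl.
exists M; split; first exact: num_real.
move=> N MN x Ax /=; apply: le_trans (mx_norm_le_enorm _) _.
exact: le_trans (AM _ Ax) (ltW MN).
Qed.

(* Main.v *)
Require Import Defs.
From mathcomp Require Import all_boot all_order all_algebra.
From mathcomp Require Import all_classical all_reals all_analysis.

(* Each term of the objective is at most F, and any two of the points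
   x_1, ..., x_k, y_1, ..., y_m are joined by at most two terms, so they lie
   within 2F of each other.  One bounded set therefore confines every feasible
   point of a sublevel set of F to a ball, and F attains its minimum over the
   product of the sets cut off by that ball, which is compact by Tychonoff. *)

Import Order.TTheory GRing.Theory Num.Theory.
Import numFieldNormedType.Exports.

Local Open Scope classical_set_scope.
Local Open Scope ring_scope.

Lemma enorm_continuous (R : realType) (n : nat) :
  continuous (@enorm R n : 'rV[R]_n -> R).
Proof.
move=> x; apply: (@continuous_comp _ _ _ _ Num.sqrt); last first.
  exact: sqrt_continuous.
move: x; apply: continuous_big => [|i _]; first exact: add_continuous.
move=> x; apply: (@continuous_comp _ _ _ _ (fun t : R => t ^+ 2)).
  exact: coord_continuous.
exact: exprn_continuous.
Qed.

(** The two families are merged into one, indexed by ['I_k + 'I_m], so that a feasible point lies in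
    a single product space. In the topology of pointwise convergence the evaluations at [inl i] and
    [inr j] are continuous. *)
Lemma heron_objective_continuous (R : realType) (n k m : nat) :
  continuous (fun f : {ptws 'I_k + 'I_m -> 'rV[R]_n} =>
    heron_objective (f \o inl, f \o inr) : R).
Proof.
apply: continuous_big => [|i _]; first exact: add_continuous.
apply: continuous_big => [|j _]; first exact: add_continuous.
move=> f; apply: (@continuous_comp {ptws 'I_k + 'I_m -> 'rV[R]_n} 'rV[R]_n R
  (fun f => f (inl i) - f (inr j)) (@enorm R n)).
  apply: cvgB; first exact: nbhs_filter.
    exact: (@proj_continuous _ (fun=> 'rV[R]_n)).
  exact: (@proj_continuous _ (fun=> 'rV[R]_n)).
exact: enorm_continuous.
Qed.

(** The left side is a sup norm, which [enorm] dominates, and the Euclidean distance is one term of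
    a sum of nonnegative terms. *)
Lemma dist_le_heron_objective (R : realType) (n k m : nat)
    (Z : ('I_k -> 'rV[R]_n) * ('I_m -> 'rV[R]_n)) (i : 'I_k) (j : 'I_m) :
  `|Z.1 i - Z.2 j| <= heron_objective Z.
Proof.
apply: le_trans (mx_norm_le_enorm _) _.
rewrite /heron_objective (bigD1 i)//= (bigD1 j)//= -addrA lerDl addr_ge0//.
  by apply: sumr_ge0 => l _; exact: enorm_ge0.
by apply: sumr_ge0 => h _; apply: sumr_ge0 => l _; exact: enorm_ge0.
Qed.

Lemma heron_objective_ge0 (R : realType) (n k m : nat)
    (Z : ('I_k -> 'rV[R]_n) * ('I_m -> 'rV[R]_n)) : 0 <= heron_objective Z.
Proof.
by apply: sumr_ge0 => i _; apply: sumr_ge0 => j _; exact: enorm_ge0.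
Qed.

Lemma dist_le2_heron_objective (R : realType) (n k m : nat)
    (hk : (0 < k)%N) (hm : (0 < m)%N) (f : 'I_k + 'I_m -> 'rV[R]_n)
    (p q : 'I_k + 'I_m) :
  `|f p - f q| <= heron_objective (f \o inl, f \o inr) *+ 2.
Proof.
set F := heron_objective _.
have F0 : 0 <= F by exact: heron_objective_ge0.
have lr i j : `|f (inl i) - f (inr j)| <= F.
  exact: (@dist_le_heron_objective _ _ _ _ (f \o inl, f \o inr)).
have rl i j : `|f (inr j) - f (inl i)| <= F by rewrite distrC.
rewrite mulr2n; case: p q => [i|j] [i'|j'].
(* Two points on the same side are joined through a point of the other side, which exists because
   [m] is positive here and [k] is in the last case; each leg is at most [F]. *)
- by apply: le_trans (ler_distD (f (inr (Ordinal hm))) _ _) _; exact: lerD.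
- by rewrite (le_trans (lr _ _))// lerDl.
- by rewrite (le_trans (rl _ _))// lerDl.
- by apply: le_trans (ler_distD (f (inl (Ordinal hk))) _ _) _; exact: lerD.
Qed.

Lemma heron_sublevel_bounded (R : realType) (n k m : nat)
    (hk : (0 < k)%N) (hm : (0 < m)%N) (X : 'I_k + 'I_m -> set 'rV[R]_n)
    (p0 : 'I_k + 'I_m) (c : R) : bounded_set (X p0) ->
  exists r : R, forall f, (forall p, X p (f p)) ->
    heron_objective (f \o inl, f \o inr) <= c -> forall p, `|f p| <= r.
Proof.
(* [c *+ 2] bounds the distance from [f p] to [f p0], and [M + 1] bounds the norm of [f p0]:
   [bounded_set] provides bounds only strictly above [M]. *)
move=> [M [_ XM]]; exists (c *+ 2 + (M + 1)) => f Xf fc p.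
rewrite -[f p](subrK (f p0)) (le_trans (ler_normD _ _))// lerD//.
  by rewrite (le_trans (dist_le2_heron_objective _ _ _ _ hk hm _ _ _))// lerMn2r.
by apply: XM (Xf p0); rewrite ltrDl.
Qed.

Theorem theorem3p1 (R : realType) (n k m : nat)
    (hn : (1 <= n)%N) (hk : (1 <= k)%N) (hm : (1 <= m)%N)
    (S : 'I_k -> set 'rV[R]_n) (C : 'I_m -> set 'rV[R]_n)
    (S_nonempty : forall i, S i !=set0)
    (S_closed : forall i, closed (S i))
    (S_convex : forall i, convex_set (S i))
    (C_nonempty : forall j, C j !=set0)
    (C_closed : forall j, closed (C j))
    (C_convex : forall j, convex_set (C j))
    (hbounded : (exists i, bounded_set (S i)) \/ (exists j, bounded_set (C j))) :
  exists2 Zstar, heron_feasible S C Zstar &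
    forall Z, heron_feasible S C Z -> heron_objective Zstar <= heron_objective Z.
Proof.
pose X (p : 'I_k + 'I_m) := match p with inl i => S i | inr j => C j end.
pose F (f : {ptws 'I_k + 'I_m -> 'rV[R]_n}) : R :=
  heron_objective (f \o inl, f \o inr).
have [p0 Xp0] : exists p, bounded_set (X p).
  by case: hbounded => [[i Si]|[j Cj]]; [exists (inl i)|exists (inr j)].
have [f0 Xf0] : exists f0, forall p, X p (f0 p).
  have /choice[x Sx] := S_nonempty; have /choice[y Cy] := C_nonempty.
  by exists (fun p => match p with inl i => x i | inr j => y j end) => -[].
have [r Fr] := heron_sublevel_bounded _ _ _ _ hk hm _ _ (F f0) Xp0.
(* The radius [r] was obtained for the level [F f0], so [K] contains every feasible family whose
   value is at most that of [f0]. *)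
pose K := [set f : {ptws 'I_k + 'I_m -> 'rV[R]_n} |
  forall p, (X p `&` closed_ball_ Num.norm 0 r) (f p)].
have inK f : (forall p, X p (f p)) -> F f <= F f0 -> K f.
  move=> Xf Ff p; split; first exact: Xf.
  by rewrite /closed_ball_ /= sub0r normrN; exact: Fr.
have cK : compact K.
  (* Each factor is closed and bounded in a finite-dimensional space, hence compact. *)
  apply: (@tychonoff _ (fun=> 'rV[R]_n)
    (fun p => X p `&` closed_ball_ Num.norm 0 r)) => p; apply: bounded_closed_compact.
    exists r; split=> [|M rM x [_]]; first exact: num_real.
    by rewrite /closed_ball_ /= sub0r normrN => /le_trans; apply; exact: ltW.
  apply: closedI; last exact: closed_closed_ball_.
  by case: p.
have [|f /set_mem Kf fmin] := compact_EVT_min _ cK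
    (continuous_subspaceT (@heron_objective_continuous R n k m)).
  by exists f0; exact: inK.
have Xf p : X p (f p) by have [] := Kf p.
exists (f \o inl, f \o inr).
  by split=> [i|j]; [exact: (Xf (inl i))|exact: (Xf (inr j))].
move=> [x y] [/= Sx Cy].
pose g p := match p with inl i => x i | inr j => y j end.
(* A competitor at or below the level of [f0] lies in [K]; any other has a larger value than [f0],
   which itself lies in [K]. *)
have [gf0|/ltW f0g] := leP (F g) (F f0).
  by apply: (fmin g); apply/mem_set/inK => // -[].
by apply: le_trans f0g; apply: fmin; exact/mem_set/inK.
Qed.
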